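(* Let $\{\boldsymbol w^*,\tilde{\boldsymbol v}^*,\boldsymbol\lambda^*\}$ denote a set of optimal primal-dual solution to the linearly constrained problem $$\min_{\tilde{\boldsymbol v},\boldsymbol w}\ f(\boldsymbol w)=\tfrac12\|\boldsymbol w-\mathrm{Proj}_{\mathcal D}\{\boldsymbol w\}\|_2^2\quad\text{s.t.}\quad \sum_{j=1}^K\boldsymbol A_j\tilde{\boldsymbol v}_j+\boldsymbol b=\boldsymbol w,$$ with $\mathcal D$, $\boldsymbol A=[\boldsymbol A_1\cdots\boldsymbol A_K]$ and $\boldsymbol b$ as defined in the context. Suppose that in the randomized ADMM algorithm (R-ADMM) described in the context the selection probability is set to $\alpha$ and the maximum number of iterations is set to $\bar t$. Furthermore, suppose the parameter $\bar\alpha$ is chosen such that $$\alpha\bar\alpha\ \ge\ (\alpha^{-2}-1).$$ Then the sequence generated by R-ADMM satisfies $$\mathbb E\big[|f(\vec{\boldsymbol w}^{\bar t})-f(\boldsymbol w^* )|\big]\ \le\ \frac{\mathrm{Const}+\frac1{2\beta}\|\boldsymbol\lambda^0-\vec{\boldsymbol\lambda}\|_2^2}{1+\alpha\cdot(\bar t-1)}$$ and $$\mathbb E\big[\|\boldsymbol A\vec{\boldsymbol v}^{\bar t}+\boldsymbol b-\vec{\boldsymbol w}^{\bar t}\|_2\big]\ \le\ \frac{\mathrm{Const}+\frac1{2\beta}\|\boldsymbol\lambda^0-\vec{\boldsymbol\lambda}\|_2^2}{C\cdot(1+\alpha\cdot(\bar t-1))},$$ where the expectation is taken over all possible realizations due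 to the random selection of the $\tilde{\boldsymbol v}^t$-subproblems, $\boldsymbol\lambda^0$ is the initial vector of $\boldsymbol\lambda$, $\mathrm{Const}$ is a constant number, and $$\vec{\boldsymbol w}^{\bar t}\triangleq\frac{\boldsymbol w^{\bar t}+\alpha\sum_{t=1}^{\bar t-1}\boldsymbol w^t}{1+\alpha\cdot(\bar t-1)},\qquad \vec{\boldsymbol v}^{\bar t}\triangleq\frac{\tilde{\boldsymbol v}^{\bar t}+\alpha\sum_{t=1}^{\bar t-1}\tilde{\boldsymbol v}^t}{1+\alpha\cdot(\bar t-1)},$$ $$\vec{\boldsymbol\lambda}=2C\cdot\frac{\boldsymbol A\vec{\boldsymbol v}^{\bar t}+\boldsymbol b-\vec{\boldsymbol w}^{\bar t}}{\|\boldsymbol A\vec{\boldsymbol v}^{\bar t}+\boldsymbol b-\vec{\boldsymbol w}^{\bar t}\|_2},\qquad C\triangleq\|\boldsymbol\lambda^*\|_2+\epsilon,$$ in which $\epsilon$ is a small positive scalar.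
   Context: **Data.** $M,N,K\ge1$ are integers (numbers of access points, antennas per access point, and users); $\boldsymbol h_k\in\mathbb C^{MN}$ and $\sigma_k$ ($1\le k\le K$; channel vectors, and noise levels with noise variance $\sigma_k^2$), $p_m$ ($1\le m\le M$; maximum transmit powers) and $s_c>0$ (a target rate) are given, and $e(s_c)\triangleq 2^{s_c}/(2^{s_c}-1)$. For $\boldsymbol v_k\in\mathbb C^{MN}$ write $\boldsymbol v_k=[\boldsymbol v_k[1]^T\cdots\boldsymbol v_k[M]^T]^T$ with $\boldsymbol v_k[m]\in\mathbb C^N$, $\tilde{\boldsymbol v}_k=[\mathrm{Re}\{\boldsymbol v_k\}^T\ \mathrm{Im}\{\boldsymbol v_k\}^T]^T\in\mathbb R^{2MN}$, and $\tilde{\boldsymbol v}=[\tilde{\boldsymbol v}_1^T\cdots\tilde{\boldsymbol v}_K^T]^T\in\mathbb R^{2MNK}$. **The matrix $\boldsymbol A$ and vector $\boldsymbol b$.** Let $$\tilde{\boldsymbol h}_k^T\triangleq[\mathrm{Re}\{\boldsymbol h_k\}^T\ \ -\mathrm{Im}\{\boldsymbol h_k\}^T],\qquad \tilde{\boldsymbol H}_k\triangleq\begin{bmatrix}\mathrm{Re}\{\boldsymbol h_k\}^T&-\mathrm{Im}\{\boldsymbol h_k\}^T\\ \mathrm{Im}\{\boldsymbol h_k\}^T&\mathrm{Re}\{\boldsymbol h_k\}^T\end{bmatrix}.$$ For $1\le k\le K$ let $\boldsymbol H_k\in\mathbb R^{(2K+2)\times 2MNK}$ be the matrix with $$\boldsymbol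 H_k\tilde{\boldsymbol v}=[(\tilde{\boldsymbol H}_k\tilde{\boldsymbol v}_1)^T\ \cdots\ (\tilde{\boldsymbol H}_k\tilde{\boldsymbol v}_K)^T\ \ 0\ \ e(s_c)^{1/2}\tilde{\boldsymbol h}_k^T\tilde{\boldsymbol v}_k]^T,$$ and let $\boldsymbol b_k=[0,\dots,0,\sigma_k,0]^T\in\mathbb R^{2K+2}$. Let $\boldsymbol P_{ap}$ be the permutation matrix with $\boldsymbol P_{ap}\tilde{\boldsymbol v}=[\breve{\boldsymbol v}_1^T\cdots\breve{\boldsymbol v}_M^T]^T$, where $\breve{\boldsymbol v}_m=[\mathrm{Re}\{\boldsymbol v_1[m]\}^T,\mathrm{Im}\{\boldsymbol v_1[m]\}^T,\dots,\mathrm{Re}\{\boldsymbol v_K[m]\}^T,\mathrm{Im}\{\boldsymbol v_K[m]\}^T]^T\in\mathbb R^{2KN}$. With $L=K(2K+2)+2MNK$, set $$\boldsymbol A=[\boldsymbol H_1^T\ \cdots\ \boldsymbol H_K^T\ \ \boldsymbol P_{ap}^T]^T\in\mathbb R^{L\times 2MNK},\qquad \boldsymbol b=[\boldsymbol b_1^T\ \cdots\ \boldsymbol b_K^T\ \ \boldsymbol 0^T]^T\in\mathbb R^L,$$ and split $\boldsymbol A=[\boldsymbol A_1\cdots\boldsymbol A_K]$ with $\boldsymbol A_j\in\mathbb R^{L\times 2MN}$, so that $\boldsymbol A\tilde{\boldsymbol v}=\sum_{j=1}^K\boldsymbol A_j\tilde{\boldsymbol v}_j$. **The set $\mathcal D$.**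 For $\tau\ge0$ let $\mathcal C(\tau)=\{[\boldsymbol x^T\ y]^T:\ \boldsymbol x\in\mathbb R^{2K+1},\ y\in\mathbb R_+,\ \|\boldsymbol x\|_2\le\tau y\}$ be the second-order cone, and let $\mathcal C=\mathcal C(e(s_c)^{1/2})$. Let $\mathcal P_m$ be the set of $\{\boldsymbol v_k[m]\}_{k=1}^K$ with $\sum_{k=1}^K\|\boldsymbol v_k[m]\|_2^2\le p_m$, i.e. in real form $\{\boldsymbol u\in\mathbb R^{2KN}:\|\boldsymbol u\|_2^2\le p_m\}$. Then $\mathcal D=\mathcal C\times\cdots\times\mathcal C\times\mathcal P_1\times\cdots\times\mathcal P_M\subset\mathbb R^L$ ($K$ copies of $\mathcal C$). $\mathrm{Proj}_{\mathcal D}$ is Euclidean projection onto $\mathcal D$. **Dual variable.** $\boldsymbol\lambda\in\mathbb R^L$ is the Lagrange multiplier of the linear constraint, with Lagrangian $f(\boldsymbol w)+\langle\boldsymbol\lambda,\boldsymbol A\tilde{\boldsymbol v}+\boldsymbol b-\boldsymbol w\rangle$; $\boldsymbol\lambda^*$ is an optimal multiplier. **R-ADMM.** Inputs: selection probability $\alpha\in(0,1]$, algorithm parameters $\beta>0$ and $\bar\alpha$, maximum number of iterations $\bar t$, and initial vectors $\tilde{\boldsymbol v}^0,\boldsymbol w^0,\boldsymbol\lambda^0$ (optionally all zero). For $t=1,\dots,\bar t$: 1. Each index $i\in\{1,\dots,K\}$ is selected with probability $\alpha$ (also conditionally on the selections of the earlier iterations); $\Lambda^t$ is the set of selected indices.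 2. For $i\in\Lambda^t$ set $\tilde{\boldsymbol v}_i^t=\arg\min_{\tilde{\boldsymbol v}_i}\frac\beta2\|\boldsymbol A_i\tilde{\boldsymbol v}_i+\boldsymbol D_i(\boldsymbol b-\boldsymbol w^{t-1}+\frac1\beta\boldsymbol\lambda^{t-1})\|_2^2$ (the $\tilde{\boldsymbol v}^t$-subproblems), where $\boldsymbol D_i$ is the $0/1$ diagonal matrix whose $l$th diagonal entry is $1$ only when the $l$th row of $\boldsymbol A_i$ is nonzero; for $i\notin\Lambda^t$ set $\tilde{\boldsymbol v}_i^t=\tilde{\boldsymbol v}_i^{t-1}$. 3. If $t<\bar t$, set $\boldsymbol w^t=\arg\min_{\boldsymbol w} f(\boldsymbol w)+\langle\boldsymbol\lambda^{t-1},\boldsymbol A\tilde{\boldsymbol v}^t+\boldsymbol b-\boldsymbol w\rangle+\frac{\alpha\beta}2\|\boldsymbol A\tilde{\boldsymbol v}^t+\boldsymbol b-\boldsymbol w\|_2^2+\frac{\bar\alpha\beta}2\|\boldsymbol w-\boldsymbol w^{t-1}\|_2^2$. If $t=\bar t$, set $\boldsymbol w^{\bar t}=\arg\min_{\boldsymbol w} f(\boldsymbol w)+\langle\boldsymbol\lambda^{\bar t-1},\boldsymbol A\tilde{\boldsymbol v}^{\bar t}+\boldsymbol b-\boldsymbol w\rangle+\frac{\beta}2\|\boldsymbol A\tilde{\boldsymbol v}^{\bar t}+\boldsymbol b-\boldsymbol w\|_2^2+\frac{\hat\alpha\beta}2\|\boldsymbol w-\boldsymbol w^{\bar t-1}\|_2^2$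 with $\hat\alpha\triangleq\alpha\bar\alpha$. 4. Set $\bar{\boldsymbol\lambda}^t=\boldsymbol\lambda^{t-1}+\beta(\boldsymbol A\tilde{\boldsymbol v}^t+\boldsymbol b-\boldsymbol w^t)$ and $\boldsymbol\lambda^t=\boldsymbol\lambda^{t-1}+\alpha(\bar{\boldsymbol\lambda}^t-\boldsymbol\lambda^{t-1})$. *)

(* Defs.v *)
From HB Require Import structures.
From mathcomp Require Export all_boot all_order all_algebra.
From mathcomp.real_closed Require Export complex.
From mathcomp Require Export all_classical all_reals all_analysis.

Set Implicit Arguments.
Unset Strict Implicit.
Unset Printing Implicit Defensive.

Import Order.TTheory GRing.Theory Num.Theory.

Local Open Scope classical_set_scope.
Local Open Scope ring_scope.

Lemma sum_if_eq_mulmx (R : pzSemiRingType) (K m n q : nat) (i : 'I_K)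
    (B : 'M[R]_(m, n)) (x : 'I_K -> 'M[R]_(n, q)) :
  \sum_j (if i == j then B else 0) *m x j = B *m x i.
Proof.
rewrite (bigD1 i) //= eqxx big1 ?addr0 // => j jDi.
by rewrite eq_sym (negPf jDi) mul0mx.
Qed.

Section Euclidean.
Variables (R : realType) (n : nat).
Implicit Types x y : 'cV[R]_n.

Definition dot x y : R := \sum_i x i 0 * y i 0.

(* The norm that the library puts on 'cV[R]_n is the sup norm. *)
Definition l2norm x : R := Num.sqrt (\sum_i x i 0 ^+ 2).

Definition is_proj (D : set 'cV[R]_n) x y :=
  D y /\ forall z, D z -> l2norm (x - y) <= l2norm (x - z).

Definition Proj (D : set 'cV[R]_n) x : 'cV[R]_n := xget 0 (is_proj D x).

Definition half_sqdist (D : set 'cV[R]_n) x : R :=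
  2^-1 * l2norm (x - Proj D x) ^+ 2.

End Euclidean.

Definition is_argmin (R : realType) (T : Type) (F : T -> R) (x : T) :=
  forall y, F x <= F y.

(* Dimensions.  Stacked vectors are block vectors for \mxcol, so MN is written
   as a sum over the access points and 2MNK as a sum over the users; the
   subvector v_k[m] of v_k is then [submxcol v_k m]. *)
Notation dimMN M N := (\sum_(m < M) N)%N.
Notation dimv M N := (\sum_(m < M) N + \sum_(m < M) N)%N.
Notation dimV M N K :=
  (\sum_(k < K) (\sum_(m < M) N + \sum_(m < M) N))%N.
Notation dimC K := (\sum_(j < K) 2 + 1 + 1)%N.
Notation dimP N K := (\sum_(k < K) (N + N))%N.
Notation dimL M N K :=
  (\sum_(k < K) (\sum_(j < K) 2 + 1 + 1) + \sum_(m < M) \sum_(k < K) (N + N))%N.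

Section ProblemData.
Variables (R : realType) (M N K : nat).

Definition e_of (sc : R) : R := 2 `^ sc / (2 `^ sc - 1).

Definition ReV n (h : 'cV[R[i]]_n) : 'cV[R]_n := map_mx (@complex.Re R) h.
Definition ImV n (h : 'cV[R[i]]_n) : 'cV[R]_n := map_mx (@complex.Im R) h.

Definition htilT (h : 'cV[R[i]]_(dimMN M N)) : 'rV[R]_(dimv M N) :=
  row_mx (ReV h)^T (- (ImV h)^T).

Definition Htil (h : 'cV[R[i]]_(dimMN M N)) : 'M[R]_(1 + 1, dimv M N) :=
  block_mx (ReV h)^T (- (ImV h)^T)
           (ImV h)^T (ReV h)^T.

Variables (h : 'I_K -> 'cV[R[i]]_(dimMN M N)) (sigma : 'I_K -> R)
  (p : 'I_M -> R) (sc : R).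

Definition Hmat (k : 'I_K) : 'M[R]_(dimC K, dimV M N K) :=
  col_mx
    (col_mx
      (\mxblock_(i < K, j < K) (if i == j then Htil (h k) else 0))
      (0 : 'M[R]_(1, dimV M N K)))
    (\mxrow_(j < K)
       (if j == k then Num.sqrt (e_of sc) *: htilT (h k) else 0)).

Lemma HmatE (k : 'I_K) (v : 'I_K -> 'cV[R]_(dimv M N)) :
  Hmat k *m (\mxcol_j v j) =
  col_mx (col_mx (\mxcol_j (Htil (h k) *m v j)) 0)
         (Num.sqrt (e_of sc) *: (htilT (h k) *m v k)).
Proof.
rewrite /Hmat !mul_col_mx mul0mx mul_mxblock_mxrow mul_mxrow_mxcol.
congr col_mx; first congr col_mx.
  by apply: eq_mxcol => i; rewrite sum_if_eq_mulmx.
under eq_bigr do rewrite eq_sym.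
by rewrite (sum_if_eq_mulmx k) -scalemxAl.
Qed.

(* [selAP m *m x] is the subvector x[m]. *)
Definition selAP (m : 'I_M) : 'M[R]_(N, dimMN M N) :=
  \mxrow_(m' < M) (if m' == m then 1%:M else 0 : 'M[R]_N).

Definition Pap : 'M[R]_(\sum_(m < M) dimP N K, dimV M N K) :=
  \mxcol_(m < M) \mxblock_(k' < K, k < K)
    (if k' == k then block_mx (selAP m) 0 0 (selAP m) else 0).

Lemma PapE (x y : 'I_K -> 'cV[R]_(dimMN M N)) :
  Pap *m (\mxcol_k col_mx (x k) (y k)) =
  \mxcol_(m < M) \mxcol_(k < K) col_mx (submxcol (x k) m) (submxcol (y k) m).
Proof.
have selE m (z : 'cV[R]_(dimMN M N)) : selAP m *m z = submxcol z m.
  rewrite -{1}[z]submxcolK mul_mxrow_mxcol; under eq_bigr do rewrite eq_sym.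
  by rewrite (sum_if_eq_mulmx m) mul1mx.
rewrite /Pap mxcol_mul; apply: eq_mxcol => m.
rewrite mul_mxblock_mxrow; apply: eq_mxcol => k.
by rewrite (sum_if_eq_mulmx k) mul_block_col !mul0mx addr0 add0r !selE.
Qed.

Definition Amat : 'M[R]_(dimL M N K, dimV M N K) :=
  col_mx (\mxcol_(k < K) Hmat k) Pap.

Definition bvec : 'cV[R]_(dimL M N K) :=
  col_mx (\mxcol_(k < K)
            (col_mx (col_mx 0 (const_mx (sigma k) : 'cV[R]_1)) (0 : 'cV[R]_1)))
         0.

Definition soc n (tau : R) : set 'cV[R]_(n + 1) :=
  [set z | 0 <= dsubmx z 0 0 /\ l2norm (usubmx z) <= tau * dsubmx z 0 0].

Definition power_ball n (q : R) : set 'cV[R]_n :=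
  [set u | l2norm u ^+ 2 <= q].

Definition Dset : set 'cV[R]_(dimL M N K) :=
  [set w | (forall k : 'I_K,
              soc (Num.sqrt (e_of sc))
                (submxcol (usubmx w) k : 'cV[R]_(dimC K))) /\
           (forall m : 'I_M,
              power_ball (p m) (submxcol (dsubmx w) m : 'cV[R]_(dimP N K)))].

End ProblemData.

(* Linearly constrained problem  min f w  s.t.  A v + b = w. *)
Section PrimalDual.
Variables (R : realType) (L n : nat).
Variables (f : 'cV[R]_L -> R) (A : 'M[R]_(L, n)) (b : 'cV[R]_L).

Definition lagrangian (v : 'cV[R]_n) (w lam : 'cV[R]_L) : R :=
  f w + dot lam (A *m v + b - w).

Definition dual_fun (lam : 'cV[R]_L) : \bar R :=
  ereal_inf [set (lagrangian vw.1 vw.2 lam)%:E | vw in [set: 'cV[R]_n * 'cV[R]_L]].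

Definition primal_optimal (v : 'cV[R]_n) (w : 'cV[R]_L) :=
  A *m v + b = w /\ forall v' w', A *m v' + b = w' -> f w <= f w'.

Definition dual_optimal (lam : 'cV[R]_L) :=
  forall lam', (dual_fun lam' <= dual_fun lam)%E.

End PrimalDual.

Section RADMM.
Variables (R : realType) (L K d : nat).
Variables (f : 'cV[R]_L -> R) (A : 'M[R]_(L, \sum_(k < K) d)) (b : 'cV[R]_L).
Variables (alpha beta abar : R) (T : nat).
Variables (v0 : 'cV[R]_(\sum_(k < K) d)) (w0 lam0 : 'cV[R]_L).

Definition Ablk (i : 'I_K) : 'M[R]_(L, d) := submxrow A i.

Definition Dmask (i : 'I_K) : 'M[R]_L :=
  diag_mx (\row_l (row l (Ablk i) != 0)%:R).

Definition v_objective (i : 'I_K) (w lam : 'cV[R]_L) (u : 'cV[R]_d) : R :=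
  beta / 2 * l2norm (Ablk i *m u + Dmask i *m (b - w + beta^-1 *: lam)) ^+ 2.

(* [c1] and [c2] weight the penalty and the proximal term. *)
Definition w_objective (c1 c2 : R) (v : 'cV[R]_(\sum_(k < K) d))
    (wprev lam w : 'cV[R]_L) : R :=
  f w + dot lam (A *m v + b - w)
  + c1 * beta / 2 * l2norm (A *m v + b - w) ^+ 2
  + c2 * beta / 2 * l2norm (w - wprev) ^+ 2.

(* [v], [w], [lam] are the iterates of a run with T iterations in which Lam t
   is the set of blocks selected at iteration t; the run is deterministic once
   Lam is given, and only the indices t <= T are constrained. *)
Record radmm_run (Lam : nat -> {set 'I_K})
    (v : nat -> 'cV[R]_(\sum_(k < K) d)) (w lam : nat -> 'cV[R]_L) : Prop := {
  run_v0 : v 0%N = v0;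
  run_w0 : w 0%N = w0;
  run_lam0 : lam 0%N = lam0;
  run_v_selected : forall t, (t < T)%N -> forall i : 'I_K, i \in Lam t.+1 ->
    is_argmin (v_objective i (w t) (lam t)) (submxcol (v t.+1) i);
  run_v_idle : forall t, (t < T)%N -> forall i : 'I_K, i \notin Lam t.+1 ->
    submxcol (v t.+1) i = submxcol (v t) i;
  run_w : forall t, (t.+1 < T)%N ->
    is_argmin (w_objective alpha abar (v t.+1) (w t) (lam t)) (w t.+1);
  run_w_last : forall t, t.+1 = T ->
    is_argmin (w_objective 1 (alpha * abar) (v t.+1) (w t) (lam t)) (w t.+1);
  run_lam : forall t, (t < T)%N ->
    let lambar := lam t + beta *: (A *m v t.+1 + b - w t.+1) in
    lam t.+1 = lam t + alpha *: (lambar - lam t)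
}.

Definition ergodic n (x : nat -> 'cV[R]_n) : 'cV[R]_n :=
  (1 + alpha * (T%:R - 1))^-1 *:
    (x T + alpha *: \sum_(1 <= t < T) x t).

End RADMM.

(* At every iteration t = 1, ..., T each index is selected with conditional
   probability alpha given any history S of the selections at iterations
   1, ..., t - 1, the conditional probability being written in product form.
   Selections of distinct indices at one iteration may be dependent. *)
Definition random_selection (R : realType) (K : nat) (alpha : R) (T : nat)
    (d : measure_display) (Omega : measurableType d) (P : probability Omega R)
    (Lam : nat -> Omega -> {set 'I_K}) : Prop :=
  (forall t i, (1 <= t <= T)%N -> measurable [set om | i \in Lam t om]) /\
  (forall t i (S : nat -> {set 'I_K}), (1 <= t <= T)%N ->
     let history := [set om | forall s, (1 <= s < t)%N -> Lam s om = S s] in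
     P ([set om | i \in Lam t om] `&` history) = (alpha%:E * P history)%E).

(* Main.v *)
Require Import Defs.
From HB Require Import structures.
From mathcomp Require Import all_boot all_order all_algebra.
From mathcomp.real_closed Require Import complex.
From mathcomp Require Import all_classical all_reals all_analysis.
From mathcomp Require Import ring lra.

Set Implicit Arguments.
Unset Strict Implicit.
Unset Printing Implicit Defensive.

Import Order.TTheory GRing.Theory Num.Theory.

Local Open Scope ring_scope.

(** Every row of A involves a single user, so the ranges of the blocks A_i are
    orthogonal and the Jacobi-type block updates are exact coordinatewise
    minimizations.  With y = A(v - vs), z = w - ws, a quadratic potential in
    (y, z, lambda) decreases along every run by at least the weighted Lagrangian
    gap, for every multiplier mu, up to a selection noise that is linear in the
    selection indicators centered at alpha.  As mu enters only the telescoping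
    part, it may depend on the run, and the noise has mean zero because it
    multiplies quantities determined by the earlier selections.  Choosing mu
    aligned with the final residual and using strong duality (f is convex with
    1-Lipschitz gradient w - Proj w) turns the gap into the two error measures. *)

(** * Euclidean inner product and norm *)

Section DotProduct.
Variables (R : realType) (n : nat).
Implicit Types (x y z : 'cV[R]_n) (c : R).

Lemma dotC x y : dot x y = dot y x.
Proof. by apply: eq_bigr => i _; rewrite mulrC. Qed.

Lemma dotDl x y z : dot (x + y) z = dot x z + dot y z.
Proof.
by rewrite /dot -big_split; apply: eq_bigr => i _; rewrite !mxE mulrDl.
Qed.

Lemma dotZl c x y : dot (c *: x) y = c * dot x y.
Proof. by rewrite /dot mulr_sumr; apply: eq_bigr => i _; rewrite !mxE mulrA. Qed.

Lemma dotNl x y : dot (- x) y = - dot x y.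
Proof. by rewrite -scaleN1r dotZl mulN1r. Qed.

Lemma dotBl x y z : dot (x - y) z = dot x z - dot y z.
Proof. by rewrite dotDl dotNl. Qed.

Lemma dot0l x : dot 0 x = 0.
Proof. by rewrite -(scale0r 0) dotZl mul0r. Qed.

Lemma dotDr x y z : dot x (y + z) = dot x y + dot x z.
Proof. by rewrite dotC dotDl !(dotC _ x). Qed.

Lemma dotZr c x y : dot x (c *: y) = c * dot x y.
Proof. by rewrite dotC dotZl dotC. Qed.

Lemma dotNr x y : dot x (- y) = - dot x y.
Proof. by rewrite dotC dotNl dotC. Qed.

Lemma dotBr x y z : dot x (y - z) = dot x y - dot x z.
Proof. by rewrite dotDr dotNr. Qed.

Lemma dot0r x : dot x 0 = 0.
Proof. by rewrite dotC dot0l. Qed.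

Definition dotE :=
  (dotDl, dotDr, dotBl, dotBr, dotNl, dotNr, dotZl, dotZr, dot0l, dot0r).

Lemma dot_suml (I : Type) (s : seq I) (F : I -> 'cV[R]_n) x :
  dot (\sum_(i <- s) F i) x = \sum_(i <- s) dot (F i) x.
Proof.
by elim/big_rec2: _ => [|i y1 y2 _ <-]; rewrite ?dot0l ?dotDl.
Qed.

Lemma dot_trmx_mul x y : dot x y = (x^T *m y) 0 0.
Proof. by rewrite mxE; apply: eq_bigr => i _; rewrite mxE. Qed.

Lemma dot_ge0 x : 0 <= dot x x.
Proof. by apply: sumr_ge0 => i _; rewrite -expr2 sqr_ge0. Qed.

Lemma dot_eq0 x : dot x x = 0 -> x = 0.
Proof.
move=> /eqP; rewrite psumr_eq0 => [/allP x0|i _]; last by rewrite -expr2 sqr_ge0.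
apply/colP => i; rewrite mxE; apply/eqP.
by have := x0 i (mem_index_enum i); rewrite mulf_eq0 orbb.
Qed.

Lemma sqr_l2norm x : l2norm x ^+ 2 = dot x x.
Proof. by rewrite sqr_sqrtr ?sumr_ge0// => i _; rewrite sqr_ge0. Qed.

Lemma l2norm_ge0 x : 0 <= l2norm x.
Proof. exact: sqrtr_ge0. Qed.

Lemma ler_l2norm x y : (l2norm x <= l2norm y) = (dot x x <= dot y y).
Proof. by rewrite -!sqr_l2norm ler_sqr // nnegrE l2norm_ge0. Qed.

(** Cauchy-Schwarz, from the nonnegative squared norm of the component of [x] orthogonal to [y]. *)
Lemma dot_le_l2norm x y : dot x y <= l2norm x * l2norm y.
Proof.
have [y0|y0] := eqVneq (dot y y) 0.
  by rewrite (dot_eq0 y0) dot0r mulr_ge0 ?l2norm_ge0.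
have yy : 0 < dot y y by rewrite lt_def y0 dot_ge0.
have /(mulr_ge0 (ltW yy)) : 0 <= dot (x - (dot x y / dot y y) *: y)
    (x - (dot x y / dot y y) *: y) by exact: dot_ge0.
rewrite !dotE (dotC y x) (_ : dot y y * _ = dot x x * dot y y - dot x y ^+ 2);
  last by field; exact/lt0r_neq0.
rewrite subr_ge0 -!sqr_l2norm -exprMn => xy.
rewrite (le_trans (ler_norm _)) // -(@ler_sqr _ `|_|) ?nnegrE //.
  by rewrite real_normK ?num_real.
by rewrite mulr_ge0 ?l2norm_ge0.
Qed.

Lemma l2normD x y : l2norm (x + y) <= l2norm x + l2norm y.
Proof.
rewrite -ler_sqr ?nnegrE ?addr_ge0 ?l2norm_ge0 //.
rewrite sqrrD !sqr_l2norm !dotE (dotC y x).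
have := dot_le_l2norm x y; lra.
Qed.

Lemma l2normZ c x : l2norm (c *: x) = `|c| * l2norm x.
Proof.
apply/eqP; rewrite -(@eqrXn2 _ 2) ?mulr_ge0 ?l2norm_ge0 //; apply/eqP.
by rewrite exprMn !sqr_l2norm !dotE real_normK ?num_real // expr2 mulrA.
Qed.

End DotProduct.

Lemma dot_mulmx (R : realType) m n (B : 'M[R]_(m, n)) x y :
  dot (B *m x) y = dot x (B^T *m y).
Proof.
by rewrite !dot_trmx_mul trmx_mul mulmxA.
Qed.

(** First-order optimality along a line: [s] is the step of a variation around a minimizer and [a],
    up to a positive factor, the directional derivative. *)
Lemma quadratic_ge0_linear (R : realType) (a c : R) :
  (forall s, 0 <= s * a + s ^+ 2 * c) -> a = 0.
Proof.
move=> H; have c1 : 0 < 1 + `|c| by rewrite ltr_pwDl.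
have k0 : 0 < (1 + `|c|)^-1 by rewrite invr_gt0.
have kc : (1 + `|c|)^-1 * c < 1.
  by rewrite mulrC ltr_pdivrMr // mul1r (le_lt_trans (ler_norm c)) // ltrDr.
(* With [k] the inverse of [1 + |c|], the value at [s = - k a] is [- k (1 - k c) a^2], where
   [k c < 1]; it can be nonnegative only if [a = 0]. *)
have := H (- ((1 + `|c|)^-1 * a)).
set k := _^-1 in k0 kc *.
rewrite (_ : _ + _ = - (k * (1 - k * c) * a ^+ 2)); last by ring.
have k1 : 0 < k * (1 - k * c) by rewrite mulr_gt0 // subr_gt0.
rewrite oppr_ge0 pmulr_rle0 // => a0; apply/eqP.
by rewrite -sqrf_eq0 eq_le a0 sqr_ge0.
Qed.

(** * Convex functions with 1-Lipschitz gradient *)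

Section Minimizers.
Variables (R : realType) (n : nat) (f : 'cV[R]_n -> R) (g : 'cV[R]_n -> 'cV[R]_n).

(* [g] is the gradient of the convex function [f], and is 1-Lipschitz. *)
Definition smooth_convex := forall x u,
  f x + dot (g x) u <= f (x + u) <= f x + dot (g x) u + 2^-1 * dot u u.

(** [q] is exactly quadratic with gradient [q'] at [x], so the step [s *: u] changes the sum by at
    most [s * dot (g x + q') u] plus a multiple of [s ^+ 2]. *)
Lemma smooth_convex_argmin (q : 'cV[R]_n -> R) (q' : 'cV[R]_n) c x :
  smooth_convex ->
  (forall u, q (x + u) = q x + dot q' u + c * dot u u) ->
  is_argmin (fun y => f y + q y) x -> g x = - q'.
Proof.
move=> fg qE xmin.
suff u0 u : dot (g x + q') u = 0.
  by apply/eqP; rewrite -addr_eq0; apply/eqP/dot_eq0/u0.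
apply: (@quadratic_ge0_linear _ _ ((2^-1 + c) * dot u u)) => s.
have := xmin (x + s *: u); rewrite qE.
have /andP[_] := fg x (s *: u); rewrite !dotE; nra.
Qed.

(** Sum of the two tangent inequalities, at [x] evaluated in [y] and at [y] evaluated in [x]. *)
Lemma smooth_convex_mono x y : smooth_convex -> 0 <= dot (g x - g y) (x - y).
Proof.
move=> fg; have /andP[+ _] := fg x (y - x); have /andP[+ _] := fg y (x - y).
by rewrite !subrKC !dotE; lra.
Qed.

End Minimizers.

(** * Projection onto a closed convex set and half the squared distance to it *)

Section Projection.
Import numFieldNormedType.Exports.
Local Open Scope classical_set_scope.
Variables (R : realType) (n : nat) (D : set 'cV[R]_n).
Hypothesis D_closed : closed D.
Hypothesis D_convex : forall x y t, 0 <= t <= 1 -> D x -> D y ->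
  D ((1 - t) *: x + t *: y).
Hypothesis D_neq0 : D !=set0.

Lemma trmx_continuous : continuous (fun r : 'rV[R]_n => r^T).
Proof.
move=> r A /nbhs_ballP [e e0 eA]; apply/nbhs_ballP; exists e => //= s [_ rs].
by apply: eA; split=> // i j; rewrite !mxE.
Qed.

Lemma l2norm_continuous (T : topologicalType) m (F : T -> 'cV[R]_m) :
  (forall i, continuous (fun t => F t i 0)) ->
  continuous (fun t => l2norm (F t)).
Proof.
move=> cF t.
apply: (continuous_comp (f := fun t => \sum_i F t i 0 ^+ 2) (g := Num.sqrt)).
  apply: cvg_big => [|i _]; first exact: add_continuous.
  by under eq_fun do rewrite expr2; exact: cvgM (cF i t) (cF i t).
exact: sqrt_continuous.
Qed.

Lemma is_proj_Proj x : is_proj D x (Proj D x).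
Proof.
rewrite /Proj; apply: xgetPex; have [z0 Dz0] := D_neq0.
(* The distance is written on row vectors, the form taken by the compactness and extreme value
   theorems below. *)
pose F (r : 'rV[R]_n) := l2norm (x - r^T).
have F_cont : continuous F.
  apply: l2norm_continuous => i.
  rewrite (_ : (fun _ => _) = (fun r : 'rV[R]_n => x i 0 - r 0 i)); last first.
    by apply/funext => r; rewrite !mxE.
  move=> r; apply: (@continuousB _ _ _ (cst (x i 0))); first exact: cst_continuous.
  exact: coord_continuous.
(* Restricting to points no farther from [x] than [z0] makes the set bounded, hence compact, and
   loses no minimizer. *)
pose E := [set r : 'rV[R]_n | D r^T /\ F r <= F z0^T].
have E_closed : closed E.
  apply: closedI; first exact: (proj1 (continuous_closedP _) trmx_continuous _ D_closed).
  exact: (proj1 (continuous_closedP _) F_cont _ (@closed_le R (F z0^T))).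
have E_compact : compact E.
  pose r0 := l2norm x + F z0^T.
  apply: (subclosed_compact E_closed (@rV_compact _ _
    (fun=> `[- r0, r0]%classic) (fun=> @segment_compact _ _ _))).
  move=> r [_ rE] i; suff : `|r 0 i| <= r0 by rewrite ler_norml /= in_itv.
  have -> : `|r 0 i| = Num.sqrt (r^T i 0 ^+ 2) by rewrite mxE sqrtr_sqr.
  apply: (@le_trans _ _ (l2norm r^T)).
    rewrite ler_wsqrtr // (bigD1 i) //= lerDl sumr_ge0 // => j _.
    by rewrite sqr_ge0.
  rewrite (_ : r^T = x + -1 *: (x - r^T)); last first.
    by rewrite scaleN1r opprB addrC subrK.
  rewrite (le_trans (l2normD _ _)) // l2normZ normrN1 mul1r.
  by rewrite lerD2l.
have E0 : E !=set0 by exists z0^T; split; rewrite ?trmxK.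
have [r rE rmin] := EVT_min_rV E0 E_compact (continuous_subspaceT F_cont).
move: rE; rewrite inE => -[Dr rz0]; exists r^T; split=> // z Dz.
have [zr|/ltW zr] := leP (F z^T) (F z0^T).
  have := rmin z^T; rewrite /F trmxK; apply.
  by rewrite inE; split; rewrite ?trmxK.
by rewrite (le_trans rz0) // (le_trans zr) // /F trmxK.
Qed.

(** The segment from the projection to [z] stays in [D], so moving along it cannot come closer to
    [x]. *)
Lemma Proj_obtuse x z : D z -> dot (x - Proj D x) (z - Proj D x) <= 0.
Proof.
move=> Dz; have [Dp pmin] := is_proj_Proj x.
set p := Proj D x in Dp pmin *; set a := dot _ _.
have H t : 0 <= t <= 1 -> 2 * t * a <= t ^+ 2 * dot (z - p) (z - p).
  move=> t01; have := pmin _ (D_convex t01 Dp Dz).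
  rewrite (_ : x - (_ + _) = x - p - t *: (z - p)); last first.
    by apply/colP => i; rewrite !mxE; ring.
  rewrite ler_l2norm [dot (x - p - _) _]dotBl !(dotBr _ _ (t *: _)).
  rewrite !(dotZl, dotZr) (dotC (z - p) (x - p)) -/a; lra.
have q0 := dot_ge0 (z - p); set q := dot (z - p) _ in q0 H.
rewrite leNgt; apply/negP => a0.
have aq : 0 < a + q by rewrite ltr_pwDl.
(* At [t = a / (a + q)] one has [t * q < a], against [2 * a <= t * q]. *)
have t1 : 0 < a / (a + q) <= 1.
  by rewrite divr_gt0 //= ler_pdivrMr // mul1r lerDl.
have /H : 0 <= a / (a + q) <= 1 by case/andP: t1 => /ltW -> ->.
set t := a / _ in t1 *; rewrite expr2 -mulrA mulrCA -mulrA ler_pM2l; last first.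
  by case/andP: t1.
have : t * (a + q) = a by rewrite mulfVK ?gt_eqF.
case/andP: t1 => t0 _; nra.
Qed.

(** Let [g] and [e] be the residuals at [x] and [x + u]. Upper bound: [Proj D x] competes with the
    projection of [x + u]. Lower bound: the obtuse angle at [Proj D x] towards [Proj D (x + u)],
    together with [0 <= dot (g - e) (g - e)]. *)
Lemma smooth_convex_half_sqdist :
  smooth_convex (half_sqdist D) (fun x => x - Proj D x).
Proof.
move=> x u.
have fE z : half_sqdist D z = 2^-1 * dot (z - Proj D z) (z - Proj D z).
  by rewrite -sqr_l2norm.
rewrite !fE.
have [Dp _] := is_proj_Proj x; have [Dq qmin] := is_proj_Proj (x + u).
have := qmin _ Dp; rewrite ler_l2norm.
have := Proj_obtuse x Dq.
have -> : Proj D (x + u) - Proj D x =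
    x - Proj D x + u - (x + u - Proj D (x + u)).
  by apply/colP => i; rewrite !mxE; ring.
have -> : x + u - Proj D x = x - Proj D x + u.
  by apply/colP => i; rewrite !mxE; ring.
move: (x - _) (x + u - _) => g e ge eg.
have := dot_ge0 (g - e); move: ge eg; rewrite !dotE (dotC e g) (dotC u g).
by move=> ge eg ee; apply/andP; split; lra.
Qed.

End Projection.

Lemma submxcolZ (R : pzRingType) k (q : 'I_k -> nat) n (a : R)
    (B : 'M[R]_(\sum_i q i, n)) i :
  submxcol (a *: B) i = a *: submxcol B i.
Proof. by apply/matrixP => j l; rewrite !mxE. Qed.

(** * Nonemptiness, convexity and closedness of [Dset] *)

Section FeasibleSet.
Import numFieldNormedType.Exports.
Local Open Scope classical_set_scope.
Variables (R : realType) (M N K : nat) (p : 'I_M -> R) (sc : R).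
Hypothesis p_ge0 : forall m, 0 <= p m.

Let D := @Dset R M N K p sc.

Lemma Dset_neq0 : D !=set0.
Proof.
have norm0 n : l2norm (0 : 'cV[R]_n) = 0 
  by rewrite /l2norm big1 ?sqrtr0 // => i _; rewrite mxE expr0n.
exists 0; split=> [k|m].
  by rewrite linear0 submxcol0 /soc /= !linear0 mxE norm0 mulr0.
by rewrite linear0 submxcol0 /power_ball /= norm0 expr0n.
Qed.

Lemma soc_convex n tau (x y : 'cV[R]_(n + 1)) s : 0 <= tau -> 0 <= s <= 1 ->
  soc tau x -> soc tau y -> soc tau ((1 - s) *: x + s *: y).
Proof.
move=> tau0 /andP[s0 s1] [x0 xs] [y0 ys]; rewrite /soc /=.
have s1' : 0 <= 1 - s by rewrite subr_ge0.
rewrite !linearD !linearZ /=.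
move: (usubmx x) (dsubmx x) (usubmx y) (dsubmx y) x0 xs y0 ys => ux dx uy dy.
move=> x0 xs y0 ys; rewrite !mxE; split; first by rewrite addr_ge0 ?mulr_ge0.
rewrite (le_trans (l2normD _ _)) // !l2normZ (ger0_norm s0) (ger0_norm s1').
rewrite !mulrDr !(mulrCA tau).
by apply: lerD; exact: ler_wpM2l.
Qed.

Lemma power_ball_convex n q (x y : 'cV[R]_n) s : 0 <= s <= 1 ->
  power_ball q x -> power_ball q y -> power_ball q ((1 - s) *: x + s *: y).
Proof.
move=> /andP[s0 s1]; rewrite /power_ball /= !sqr_l2norm !dotE (dotC y x).
have s1' : 0 <= 1 - s by rewrite subr_ge0.
(* This product is exactly the convexity deficit of the squared norm on the segment. *)
have := mulr_ge0 (mulr_ge0 s0 s1') (dot_ge0 (x - y)).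
rewrite !dotE (dotC y x) => xy /(ler_wpM2l s1') xq /(ler_wpM2l s0) yq; lra.
Qed.

Lemma Dset_convex x y s : 0 <= s <= 1 -> D x -> D y ->
  D ((1 - s) *: x + s *: y).
Proof.
move=> s01 [xC xP] [yC yP]; split=> [k|m]; rewrite !linearD !linearZ /=.
  rewrite submxcolD !submxcolZ; apply: soc_convex => //; exact: sqrtr_ge0.
rewrite submxcolD !submxcolZ; exact: power_ball_convex.
Qed.

Lemma Dset_closed : closed D.
Proof.
(* Nested block extraction only reads one coordinate of [w]; unfolding finds its index. *)
have coord_comp m n (F : 'cV[R]_m -> 'cV[R]_n) (i : 'I_n) :
    (exists j, forall w, F w i 0 = w j 0) -> continuous (fun w => F w i 0).
  move=> [j Fj].
  rewrite (_ : (fun _ => _) = (fun w : 'cV[R]_m => w j 0)); last exact/funext.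
  exact: coord_continuous.
pose c (k : 'I_K) (w : 'cV[R]_(dimL M N K)) : 'cV[R]_(dimC K) :=
  submxcol (usubmx w) k.
pose q (m : 'I_M) (w : 'cV[R]_(dimL M N K)) : 'cV[R]_(dimP N K) :=
  submxcol (dsubmx w) m.
have cc k i : continuous (fun w => usubmx (c k w) i 0).
  apply: coord_comp; eexists => w; rewrite !mxE; reflexivity.
have dc k : continuous (fun w => dsubmx (c k w) 0 0).
  apply: coord_comp; eexists => w; rewrite !mxE; reflexivity.
have qc m i : continuous (fun w => q m w i 0).
  apply: coord_comp; eexists => w; rewrite !mxE; reflexivity.
have closed_preim (T : topologicalType) (F : T -> R) A :
    continuous F -> closed A -> closed (F @^-1` A).
  by move=> /continuous_closedP; apply.
have -> : D =
    \bigcap_(k in setT) ((fun w => dsubmx (c k w) 0 0) @^-1` [set r | 0 <= r] `&`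
      (fun w => l2norm (usubmx (c k w)) - Num.sqrt (e_of sc) * dsubmx (c k w) 0 0)
        @^-1` [set r | r <= 0])
    `&` \bigcap_(m in setT) ((fun w => l2norm (q m w) ^+ 2) @^-1` [set r | r <= p m]).
  rewrite predeqE => w; split=> -[wC wP].
    split=> [k _|m _]; last exact: wP.
    by have [? ?] := wC k; split=> //=; rewrite subr_le0.
  split=> [k|m]; last exact: wP.
  by have [? /=] := wC k Logic.I; rewrite subr_le0; split.
apply: closedI; apply: closed_bigI => k _.
  apply: closedI; first exact: closed_preim (dc k) (@closed_ge R 0).
  apply: closed_preim (@closed_le R 0) => w.
  pose F w := l2norm (usubmx (c k w)).
  apply: (@continuousB _ _ _ F); first exact: l2norm_continuous (cc k) w.
  pose a : 'cV[R]_(dimL M N K) -> R := cst (Num.sqrt (e_of sc)).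
  by apply: (@continuousM _ _ a); [exact: cst_continuous|exact: dc].
pose F w := l2norm (q k w); have F_cont := l2norm_continuous (qc k).
apply: (closed_preim _ _ _ _ (@closed_le R (p k))) => w.
apply: (continuous_comp (f := F) (g := fun r => r ^+ 2)); first exact: F_cont.
exact: exprn_continuous.
Qed.

Lemma smooth_convex_Dset :
  smooth_convex (half_sqdist D) (fun w => w - Proj D w).
Proof.
exact: smooth_convex_half_sqdist Dset_closed Dset_convex Dset_neq0.
Qed.

End FeasibleSet.

(** * Orthogonality of the column blocks of the constraint matrix *)

Section Amat.
Variables (R : realType) (M N K : nat).

Lemma dot_col_mx m n (x x' : 'cV[R]_m) (y y' : 'cV[R]_n) :
  dot (col_mx x y) (col_mx x' y') = dot x x' + dot y y'.
Proof.
rewrite /dot big_split_ord; congr (_ + _); apply: eq_bigr => i _.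
  by rewrite !col_mxEu.
by rewrite !col_mxEd.
Qed.

Lemma dot_mxcol k (q : 'I_k -> nat) (x y : forall i, 'cV[R]_(q i)) :
  dot (\mxcol_i x i) (\mxcol_i y i) = \sum_i dot (x i) (y i).
Proof.
rewrite dot_trmx_mul tr_mxcol mul_mxrow_mxcol summxE.
by apply: eq_bigr => i _; rewrite dot_trmx_mul.
Qed.

Variables (h : 'I_K -> 'cV[R[i]]_(dimMN M N)) (sc : R).
Let A := Amat h sc.

(** Padding with zero blocks makes product formulas for full stacked vectors, such as [HmatE], apply
    to a single block. *)
Lemma mul_AblkE L k d (B : 'M[R]_(L, \sum_(i < k) d)) (i : 'I_k) (u : 'cV[R]_d) :
  Ablk B i *m u = B *m \mxcol_j (if i == j then u else 0).
Proof.
rewrite -[B in RHS]submxrowK mul_mxrow_mxcol (bigD1 i) //= eqxx big1 ?addr0 //.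
by move=> j; rewrite eq_sym => /negPf ->; rewrite mulmx0.
Qed.

(* Every row of A involves a single user. *)
Lemma dot_Ablk_Amat (i j : 'I_K) u v : i != j ->
  dot (Ablk A i *m u) (Ablk A j *m v) = 0.
Proof.
move=> ij; rewrite !mul_AblkE /A /Amat !mul_col_mx dot_col_mx.
(* At user [k] at most one of the two padded vectors has a nonzero block, since [i != j]. *)
have ortho n (B B' : 'I_K -> 'M[R]_(n, Defs.dimv M N)) k :
  dot (B k *m (if i == k then u else 0)) (B' k *m (if j == k then v else 0)) = 0.
  case: eqVneq => [<-|_]; last by rewrite mulmx0 dot0l.
  by rewrite eq_sym (negPf ij) mulmx0 dot0r.
rewrite !mxcol_mul dot_mxcol big1 => [|k _]; last first.
  rewrite !HmatE !dot_col_mx dot_mxcol dot0l addr0 big1 ?add0r => [|l _].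
    by rewrite !dotE (ortho _ (fun k => htilT (h k)) (fun k => htilT (h k))) !mulr0.
  exact: (ortho _ (fun=> Htil (h k)) (fun=> Htil (h k))).
rewrite add0r /Pap dot_mxcol big1 // => m _.
rewrite !mul_mxblock_mxrow dot_mxcol big1 // => k _.
rewrite !(sum_if_eq_mulmx k).
exact: (ortho _ (fun=> _) (fun=> _)).
Qed.

End Amat.

(** * Strong duality for the linearly constrained problem *)

Section StrongDuality.
Variables (R : realType) (L n : nat).
Variables (f : 'cV[R]_L -> R) (g : 'cV[R]_L -> 'cV[R]_L).
Variables (A : 'M[R]_(L, n)) (b : 'cV[R]_L).
Hypothesis fg : smooth_convex f g.

(* [g ws] is a Lagrange multiplier, so the dual optimal value is [f ws]. *)
Lemma dual_optimal_saddle vs ws lams :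
  primal_optimal f A b vs ws -> dual_optimal f A b lams ->
  forall v w, f ws <= lagrangian f A b v w lams.
Proof.
move=> [feas wsmin] dopt v w.
(* Moving [vs] along [x] and [ws] along [A *m x] keeps the constraint, so the derivative of [f] in
   that direction is zero. *)
have gA x : dot (g ws) (A *m x) = 0.
  apply: (@quadratic_ge0_linear _ _ (2^-1 * dot (A *m x) (A *m x))) => s.
  have := wsmin (vs + s *: x) (ws + s *: (A *m x)).
  rewrite mulmxDr -scalemxAr addrAC feas => /(_ erefl).
  have /andP[_] := fg ws (s *: (A *m x)); rewrite !dotE; lra.
(* By this orthogonality the multiplier term at [(v', w')] equals [- dot (g ws) (w' - ws)], and
   convexity of [f] at [ws] bounds the Lagrangian below. *)
have dual_g : ((f ws)%:E <= dual_fun f A b (g ws))%E.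
  apply: le_ereal_inf_tmp => _ [[v' w'] _ <-]; rewrite lee_fin /lagrangian /=.
  have : dot (g ws) (A *m v' + b - w') = - dot (g ws) (w' - ws).
    rewrite -[RHS](add0r) -(gA (v' - vs)) mulmxBr -feas !dotE; ring.
  have /andP[+ _] := fg ws (w' - ws); rewrite subrKC; lra.
rewrite -lee_fin (le_trans dual_g) // (le_trans (dopt _)) //.
by apply: ereal_inf_lbound; exists (v, w).
Qed.

End StrongDuality.

(** * Optimality conditions and uniqueness for the subproblems *)

Section Iterates.
Variables (R : realType) (L K d : nat).
Variables (f : 'cV[R]_L -> R) (g : 'cV[R]_L -> 'cV[R]_L).
Variables (A : 'M[R]_(L, \sum_(k < K) d)) (b : 'cV[R]_L).
Variables (alpha beta abar : R).
Hypothesis fg : smooth_convex f g.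
Hypothesis A_orth : forall (i j : 'I_K) u v, i != j ->
  dot (Ablk A i *m u) (Ablk A j *m v) = 0.
Hypothesis beta_gt0 : 0 < beta.

Lemma mulmx_blocks (v : 'cV[R]_(\sum_(k < K) d)) :
  A *m v = \sum_i Ablk A i *m submxcol v i.
Proof. by rewrite -[A in LHS]submxrowK -[v in LHS]submxcolK mul_mxrow_mxcol. Qed.

(** The mask erases only rows on which the block is zero, so the range of the block does not see
    it. *)
Lemma Ablk_masked (i : 'I_K) u c :
  dot (Ablk A i *m u) (Dmask A i *m c) = dot (Ablk A i *m u) c.
Proof.
apply: eq_bigr => l _; rewrite mul_diag_mx !mxE.
case: eqVneq => [Al0|_]; last by rewrite mul1r.
rewrite big1 ?mul0r // => j _; have /rowP/(_ j) := Al0.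
by rewrite !mxE => ->; rewrite mul0r.
Qed.

Lemma v_objective_argmin (i : 'I_K) w lam u x :
  is_argmin (v_objective A b beta i w lam) u ->
  dot (Ablk A i *m x) (Ablk A i *m u + (b - w + beta^-1 *: lam)) = 0.
Proof.
move=> umin; rewrite dotDr -(Ablk_masked i x (_ + _)) -dotDr.
apply: (@quadratic_ge0_linear _ _ (2^-1 * dot (Ablk A i *m x) (Ablk A i *m x))).
move=> s; have := umin (u + s *: x); rewrite /v_objective.
rewrite [_ *m (u + _)]mulmxDr -scalemxAr [X in _ <= _ * l2norm X ^+ 2]addrAC.
rewrite ler_pM2l ?divr_gt0 // !sqr_l2norm.
move: (_ + Dmask _ _ *m _) => e.
rewrite !dotE (dotC e (_ *m x)); lra.
Qed.

(** The block may fail to be injective, so only the image of the minimizer is determined: by the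
    normal equations, the difference of the two images is orthogonal to itself. *)
Lemma v_objective_argmin_uniq (i : 'I_K) w lam u u' :
  is_argmin (v_objective A b beta i w lam) u ->
  is_argmin (v_objective A b beta i w lam) u' -> Ablk A i *m u = Ablk A i *m u'.
Proof.
move=> um um'; apply/subr0_eq/dot_eq0.
have := v_objective_argmin (u - u') um; have := v_objective_argmin (u - u') um'.
by rewrite mulmxBr !dotE (dotC _ (Ablk A i *m u)); lra.
Qed.

Section WUpdate.
Variables (c1 c2 : R) (v : 'cV[R]_(\sum_(k < K) d)) (wp lam : 'cV[R]_L).

(** Gradient in [w] of every term of [w_objective] except [f w]. *)
Definition w_penalty_grad w :=
  - lam - (c1 * beta) *: (A *m v + b - w) + (c2 * beta) *: (w - wp).

Lemma w_objective_argmin w :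
  is_argmin (w_objective f A b beta c1 c2 v wp lam) w -> g w = - w_penalty_grad w.
Proof.
move=> wmin.
pose q w := dot lam (A *m v + b - w)
  + c1 * beta / 2 * l2norm (A *m v + b - w) ^+ 2
  + c2 * beta / 2 * l2norm (w - wp) ^+ 2.
apply: (smooth_convex_argmin (q := q) (c := (c1 + c2) * beta / 2) fg) => [u|y].
  rewrite /q !sqr_l2norm /w_penalty_grad opprD !addrA.
  rewrite (_ : w + u - wp = w - wp + u); last by rewrite addrAC.
  move: (A *m v + b - w) (w - wp) => r e.
  by rewrite !dotE (dotC u r) (dotC u e) (dotC r u); field.
by have := wmin y; rewrite /w_objective /q !addrA.
Qed.

(** The quadratic terms have curvature [(c1 + c2) * beta], while [g] is monotone. *)
Lemma w_objective_argmin_uniq w w' : 0 < c1 + c2 ->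
  is_argmin (w_objective f A b beta c1 c2 v wp lam) w ->
  is_argmin (w_objective f A b beta c1 c2 v wp lam) w' -> w = w'.
Proof.
move=> c0 /w_objective_argmin gw /w_objective_argmin gw'.
apply/subr0_eq/dot_eq0/eqP; rewrite eq_le dot_ge0 andbT.
have := smooth_convex_mono w w' fg; rewrite gw gw'.
have -> : - w_penalty_grad w - - w_penalty_grad w' =
    - ((c1 + c2) * beta) *: (w - w').
  by apply/colP => i; rewrite !mxE; ring.
by rewrite dotZl mulNr oppr_ge0 pmulr_rle0 // mulr_gt0.
Qed.

End WUpdate.

End Iterates.

(** * One-step decrease of the quadratic potential *)

Section Potential.
Variables (R : realType) (L : nat) (alpha beta abar : R).
Hypothesis alpha01 : 0 < alpha <= 1.
Hypothesis beta_gt0 : 0 < beta.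
Hypothesis abar_ge : alpha ^- 2 - 1 <= alpha * abar.
Implicit Types (x y z l mu : 'cV[R]_L).

(* [y], [z], [l] stand for [A *m (v - vs)], [w - ws] and [lam]. *)
Definition potential mu y z l : R :=
  (2 * beta)^-1 * dot (l - mu) (l - mu)
  + beta * (1 + alpha * abar) / 2 * dot z z
  + (1 - alpha) * dot y (l + beta *: (y - z)).

(** A block stays idle with probability [1 - alpha]; the new cross term is compared with that share
    of the old one, so that the drift has conditional mean zero along a run. *)
Definition drift y z l y' : R :=
  dot y' (l + beta *: (y' - z)) - (1 - alpha) * dot y (l + beta *: (y - z)).

Let alpha_neq0 : alpha != 0.
Proof. by case/andP: alpha01 => /lt0r_neq0. Qed.

Let beta_neq0 : beta != 0. Proof. exact: lt0r_neq0. Qed.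

Let slack_ge0 : 0 <= 1 + alpha * abar - alpha ^- 2.
Proof. by move: abar_ge; lra. Qed.

(** The vector paired with [z'] on the left is the gradient of [f] at the new [w]. The two sides
    differ by [beta / 2] times the square of [e] plus [1 + alpha * abar - alpha ^- 2] times that of
    [z' - z], a coefficient that [abar_ge] makes nonnegative. *)
Lemma potential_step mu y z l y' z' :
  alpha * (dot (l + (alpha * beta) *: (y' - z') - (abar * beta) *: (z' - z)) z'
           + dot mu (y' - z'))
  <= potential mu y z l - potential mu y' z' (l + (alpha * beta) *: (y' - z'))
     + drift y z l y'.
Proof.
rewrite -subr_ge0; set d := _ - _.
pose e := alpha *: (y' - z') + alpha^-1 *: (z' - z).
have -> : d = beta / 2 * (dot e e
    + (1 + alpha * abar - alpha ^- 2) * dot (z' - z) (z' - z)).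
  rewrite /d /e /potential /drift !dotE.
  rewrite (dotC z z') (dotC z y') (dotC l y') (dotC l z') (dotC z' y').
  rewrite (dotC mu y') (dotC mu z') (dotC mu l); field.
  by rewrite alpha_neq0 beta_neq0.
apply: mulr_ge0; first by rewrite divr_ge0 // ltW.
by rewrite addr_ge0 ?mulr_ge0 ?dot_ge0.
Qed.

(** With penalty weight 1, completing squares leaves only nonnegative terms, and no potential is
    carried over; [abar_ge] enters through [0 <= alpha * abar]. *)
Lemma potential_last_step mu y z l y' z' :
  dot (l + beta *: (y' - z') - (alpha * abar * beta) *: (z' - z)) z'
  + dot mu (y' - z')
  <= potential mu y z l + drift y z l y'.
Proof.
have [a0 a1] := andP alpha01; rewrite -subr_ge0; set d := _ - _.
pose e := (y' - z') + (z' - z); pose k := l + beta *: (y' - z') - mu.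
have -> : d = (2 * beta)^-1 * dot k k + beta / 2 * (dot e e + dot z' z'
    + (alpha * abar) * dot z' z' + (alpha * abar) * dot (z' - z) (z' - z)).
  rewrite /d /e /k /potential /drift !dotE.
  rewrite (dotC z z') (dotC z y') (dotC l y') (dotC l z') (dotC z' y').
  rewrite (dotC mu y') (dotC mu z') (dotC mu l); field.
  by rewrite beta_neq0.
have aa : 0 <= alpha * abar.
  apply: le_trans abar_ge; rewrite subr_ge0 invf_ge1 ?exprn_gt0 //.
  by rewrite exprn_ile1 // ltW.
have b0 := ltW beta_gt0.
apply: addr_ge0; first by rewrite mulr_ge0 ?dot_ge0 // invr_ge0 mulr_ge0.
apply: mulr_ge0; first by rewrite divr_ge0.
by do !apply: addr_ge0; rewrite ?dot_ge0 // mulr_ge0 ?dot_ge0.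
Qed.

End Potential.

(** * Weighted ergodic averages *)

Section Ergodic.
Variables (R : realType) (alpha : R) (T : nat).
Hypothesis alpha01 : 0 < alpha <= 1.
Hypothesis T_gt0 : (0 < T)%N.

Definition total_weight : R := 1 + alpha * (T%:R - 1).

Lemma total_weight_gt0 : 0 < total_weight.
Proof.
have [a0 _] := andP alpha01; rewrite /total_weight ltr_pwDl // mulr_ge0 ?(ltW a0) //.
by rewrite subr_ge0 ler1n.
Qed.

Lemma sum_weights : total_weight = 1 + alpha * \sum_(1 <= t < T) 1.
Proof. by rewrite sumr_const_nat natrB. Qed.

Lemma dot_ergodic n (u : 'cV[R]_n) (x : nat -> 'cV[R]_n) :
  total_weight * dot u (ergodic alpha T x) =
  dot u (x T) + alpha * \sum_(1 <= t < T) dot u (x t).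
Proof.
rewrite /ergodic -/total_weight dotZr mulVKf ?lt0r_neq0 ?total_weight_gt0 //.
rewrite dotDr dotZr (dotC u (\sum_(_ <= _ < _) _)) dot_suml.
by under eq_bigr do rewrite dotC.
Qed.

End Ergodic.

(** * Pathwise estimates along one run *)

Section Run.
Variables (R : realType) (L K d : nat).
Variables (f : 'cV[R]_L -> R) (g : 'cV[R]_L -> 'cV[R]_L).
Variables (A : 'M[R]_(L, \sum_(k < K) d)) (b : 'cV[R]_L).
Variables (alpha beta abar : R).
Hypothesis fg : smooth_convex f g.
Hypothesis A_orth : forall (i j : 'I_K) u v, i != j ->
  dot (Ablk A i *m u) (Ablk A j *m v) = 0.
Hypothesis alpha01 : 0 < alpha <= 1.
Hypothesis beta_gt0 : 0 < beta.
Hypothesis abar_ge : alpha ^- 2 - 1 <= alpha * abar.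

Let alpha_gt0 : 0 < alpha. Proof. by case/andP: alpha01. Qed.

Lemma abar_ge0 : 0 <= abar.
Proof.
rewrite -(pmulr_rge0 _ alpha_gt0) (le_trans _ abar_ge) // subr_ge0.
have [a0 a1] := andP alpha01.
by rewrite invf_ge1 ?exprn_gt0 // exprn_ile1 // ltW.
Qed.

Variables (T : nat) (v0 : 'cV[R]_(\sum_(k < K) d)) (w0 lam0 : 'cV[R]_L).

Notation run := (radmm_run f A b alpha beta abar T v0 w0 lam0).

Lemma run_lamE Lam v w lam t : run Lam v w lam -> (t < T)%N ->
  lam t.+1 = lam t + (alpha * beta) *: (A *m v t.+1 + b - w t.+1).
Proof. by move=> r tT; rewrite (run_lam r) //= addrAC subrr add0r scalerA. Qed.

(** This makes the iterates adapted to the selections. For [v] only the block images are determined,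
    but the [w] and multiplier updates see [v] only through [A *m v]. *)
Lemma run_determined Lam v w lam Lam' v' w' lam' t :
  run Lam v w lam -> run Lam' v' w' lam' -> (t <= T)%N ->
  (forall s, (1 <= s <= t)%N -> Lam s = Lam' s) ->
  [/\ forall i, Ablk A i *m submxcol (v t) i = Ablk A i *m submxcol (v' t) i,
      w t = w' t & lam t = lam' t].
Proof.
move=> r r'; elim: t => [_ _|t IH tT LamE].
  rewrite (run_v0 r) (run_v0 r') (run_w0 r) (run_w0 r') (run_lam0 r) (run_lam0 r').
  by split.
have [|Bv wE lamE] := IH (ltnW tT).
  by move=> s /andP[s1 st]; rewrite LamE // s1 ltnW.
have Bv1 i : Ablk A i *m submxcol (v t.+1) i = Ablk A i *m submxcol (v' t.+1) i.
  have LE := LamE t.+1 (leqnn _).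
  have [iL|iL] := boolP (i \in Lam t.+1).
    have iL' : i \in Lam' t.+1 by rewrite -LE.
    apply: (v_objective_argmin_uniq beta_gt0 (run_v_selected r tT iL)).
    by rewrite wE lamE; exact: (run_v_selected r' tT iL').
  have iL' : i \notin Lam' t.+1 by rewrite -LE.
  by rewrite (run_v_idle r tT iL) (run_v_idle r' tT iL').
have AvE : A *m v t.+1 = A *m v' t.+1.
  by rewrite !mulmx_blocks; apply: eq_bigr => i _.
have wE1 : w t.+1 = w' t.+1.
  have objE c1 c2 : w_objective f A b beta c1 c2 (v t.+1) (w t) (lam t) =
      w_objective f A b beta c1 c2 (v' t.+1) (w' t) (lam' t).
    by rewrite /w_objective AvE wE lamE.
  move: (tT); rewrite leq_eqVlt => /predU1P[tE|tT'].
    apply: (w_objective_argmin_uniq fg beta_gt0 _ (run_w_last r tE)).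
      by rewrite ltr_pwDl // mulr_ge0 ?abar_ge0 // ltW.
    by rewrite objE; exact: (run_w_last r' tE).
  apply: (w_objective_argmin_uniq fg beta_gt0 _ (run_w r tT')).
    by rewrite ltr_pwDl ?abar_ge0.
  by rewrite objE; exact: (run_w r' tT').
by split=> //; rewrite (run_lamE r tT) (run_lamE r' tT) AvE wE1 lamE.
Qed.

Variables (vs : 'cV[R]_(\sum_(k < K) d)) (ws : 'cV[R]_L).
Hypothesis feasible : A *m vs + b = ws.

Section OneRun.
Variables (Lam : nat -> {set 'I_K}) (v : nat -> 'cV[R]_(\sum_(k < K) d)).
Variables (w lam : nat -> 'cV[R]_L).
Hypothesis r : run Lam v w lam.

Let y t := A *m (v t - vs).
Let z t := w t - ws.
Let Y i t := Ablk A i *m (submxcol (v t) i - submxcol vs i).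

(** [beta] times the left side of the normal equation of block [i] at the old block, tested against
    [Y i t], with [b] eliminated by feasibility and orthogonality. *)
Definition block_defect i t : R :=
  dot (Y i t) (lam t + beta *: (Y i t - z t)).

Definition selection_noise t : R :=
  \sum_i ((i \in Lam t.+1)%:R - alpha) * block_defect i t.

Let yE t : y t = \sum_i Y i t.
Proof.
by rewrite /y mulmx_blocks; apply: eq_bigr => i _; rewrite submxcolB.
Qed.

Let resE t : A *m v t + b - w t = y t - z t.
Proof. by rewrite /y /z mulmxBr -feasible; apply/colP => i; rewrite !mxE; ring. Qed.

(** Orthogonality removes the cross terms, so the quadratic part separates over the blocks. *)
Let dot_blocks t l u : dot (y t) (l + beta *: (y t - u)) =
  \sum_i dot (Y i t) (l + beta *: (Y i t - u)).
Proof.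
rewrite [in LHS]yE dot_suml; apply: eq_bigr => i _.
rewrite !dotE; congr (_ + _ * (_ - _)).
rewrite dotC dot_suml (bigD1 i) //= big1 ?addr0 // => j ji.
by rewrite /Y A_orth.
Qed.

(** In the new cross term a selected block contributes 0 by its normal equation, and an idle block
    contributes its old defect. *)
Lemma drift_noise t : (t < T)%N ->
  drift alpha beta (y t) (z t) (lam t) (y t.+1) = - selection_noise t.
Proof.
move=> tT; rewrite /drift !dot_blocks mulr_sumr -sumrB -sumrN.
apply: eq_bigr => i _; rewrite -/(block_defect i t).
have [iL|iL] := boolP (i \in Lam t.+1); last first.
  rewrite (_ : Y i t.+1 = Y i t); last by rewrite /Y (run_v_idle r tT iL).
  by rewrite -/(block_defect i t) /=; ring.
rewrite /= (_ : dot _ _ = 0); first by ring.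
have := v_objective_argmin beta_gt0
  (submxcol (v t.+1) i - submxcol vs i) (run_v_selected r tT iL).
rewrite -/(Y i t.+1) => /(congr1 ( *%R beta)); rewrite mulr0 => <-.
have : dot (Y i t.+1) (A *m vs) = dot (Y i t.+1) (Ablk A i *m submxcol vs i).
  rewrite mulmx_blocks dotC dot_suml (bigD1 i) //= big1 ?addr0 1?dotC // => j ji.
  by rewrite /Y A_orth.
rewrite /z -feasible [in X in _ + beta *: (X - _)]/Y mulmxBr.
move: (Y i t.+1) => e; rewrite !dotE => ->; field.
exact: lt0r_neq0.
Qed.

Definition gap mu t : R := f (w t) - f ws + dot mu (A *m v t + b - w t).

Let f_gap t e : g (w t) = e -> f (w t) - f ws <= dot e (z t).
Proof.
move=> <-; have /andP[+ _] := fg (w t) (ws - w t); rewrite subrKC.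
by rewrite -(opprB (w t)) dotNr -/(z t); lra.
Qed.

Let pot mu t := potential alpha beta abar mu (y t) (z t) (lam t).

(** Stationarity in [w] identifies [g (w t.+1)] with the vector in [potential_step]; convexity then
    bounds the gap in [f]. *)
Lemma gap_step mu t : (t.+1 < T)%N ->
  alpha * gap mu t.+1 <= pot mu t - pot mu t.+1 - selection_noise t.
Proof.
move=> tT; have tT' := ltnW tT.
rewrite -(drift_noise tT').
have := potential_step alpha01 beta_gt0 abar_ge mu (y t) (z t) (lam t) (y t.+1) (z t.+1).
rewrite -resE -(run_lamE r tT') => /(le_trans _); apply.
rewrite ler_pM2l // /gap resE lerD2r; apply: f_gap.
rewrite (w_objective_argmin fg (run_w r tT)) /w_penalty_grad (run_lamE r tT').
by apply/colP => i; rewrite /z !mxE; ring.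
Qed.

Lemma gap_last_step mu t : t.+1 = T ->
  gap mu T <= pot mu t - selection_noise t.
Proof.
move=> tT; have tT' : (t < T)%N by rewrite -tT.
rewrite -(drift_noise tT') -tT.
apply: le_trans (potential_last_step alpha01 beta_gt0 abar_ge mu _ _ _ _ (z t.+1)).
rewrite /gap resE lerD2r; apply: f_gap.
rewrite (w_objective_argmin fg (run_w_last r tT)) /w_penalty_grad resE.
by apply/colP => i; rewrite /z !mxE; ring.
Qed.

(** Telescoping; the weights, [alpha] before the last iteration and 1 at it, are those of
    [ergodic]. *)
Lemma gap_sum mu : (0 < T)%N ->
  gap mu T + alpha * \sum_(1 <= t < T) gap mu t
  <= pot mu 0 - \sum_(0 <= t < T) selection_noise t.
Proof.
case TE : T => [//|n] _.
have H m : (m < T)%N -> alpha * \sum_(1 <= t < m.+1) gap mu t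
    <= pot mu 0 - pot mu m - \sum_(0 <= t < m) selection_noise t.
  elim: m => [_|m IH mT]; first by rewrite !big_geq // mulr0 subrr subr0.
  rewrite (big_nat_recr m.+1) //= (big_nat_recr m 0%N) //= mulrDr.
  have := gap_step mu mT; have := IH (ltnW mT); lra.
have := gap_last_step mu (esym TE); rewrite TE (big_nat_recr n 0%N) //=.
have := H n; rewrite TE => /(_ (leqnn _)); lra.
Qed.

Let vavg := ergodic alpha T v.
Let wavg := ergodic alpha T w.

(** Jensen's inequality. Replacing [f] by its tangent at [wavg] gives [aff], which is affine, lies
    below the gap at each iterate and agrees with it at the averages. *)
Lemma gap_ergodic mu : (0 < T)%N ->
  total_weight alpha T * (f wavg - f ws + dot mu (A *m vavg + b - wavg))
  <= gap mu T + alpha * \sum_(1 <= t < T) gap mu t.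
Proof.
move=> T0.
pose c := f wavg - f ws - dot (g wavg) wavg + dot mu b.
pose aff x u := c + dot (g wavg - mu) u + dot (A^T *m mu) x.
have dotA x : dot mu (A *m x) = dot (A^T *m mu) x by rewrite dotC dot_mulmx dotC.
have aff_gap t : aff (v t) (w t) <= gap mu t.
  rewrite /aff /c /gap -dotA; have /andP[+ _] := fg wavg (w t - wavg).
  by rewrite subrKC !dotE; lra.
have -> : f wavg - f ws + dot mu (A *m vavg + b - wavg) = aff vavg wavg.
  by rewrite /aff /c -dotA !dotE; ring.
rewrite {1}/aff (mulrDr _ (c + _)) (mulrDr _ c) !dot_ergodic // sum_weights //.
apply: le_trans (_ : aff (v T) (w T) + alpha * \sum_(1 <= t < T) aff (v t) (w t) <= _).
  have sum_c : \sum_(1 <= t < T) c = c * \sum_(1 <= t < T) 1.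
    by rewrite mulr_sumr; apply: eq_bigr => t _; rewrite mulr1.
  by rewrite /aff 2!big_split /= sum_c; lra.
rewrite lerD // ler_wpM2l ?(ltW alpha_gt0) //.
by apply: ler_sum => t _.
Qed.

(** The noise does not involve [mu], so [mu] may be chosen after the whole run is known. *)
Lemma ergodic_run_bound mu : (0 < T)%N ->
  total_weight alpha T * (f wavg - f ws + dot mu (A *m vavg + b - wavg))
  <= potential alpha beta abar mu (A *m (v0 - vs)) (w0 - ws) lam0
     - \sum_(0 <= t < T) selection_noise t.
Proof.
move=> T0; apply: (le_trans (gap_ergodic mu T0)).
by have := gap_sum mu T0; rewrite /pot /y /z (run_v0 r) (run_w0 r) (run_lam0 r).
Qed.

End OneRun.
End Run.

(* The multiplier aligned with the residual turns the Lagrangian gap at the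
   ergodic point into a bound on both error measures. *)
Lemma aligned_gap (R : realType) L (lams res : 'cV[R]_L) (eps gapf : R) :
  let C := l2norm lams + eps in
  let gapL := gapf + dot ((2 * C / l2norm res) *: res) res in
  0 < eps -> 0 <= gapf + dot lams res ->
  `|gapf| <= gapL /\ C * l2norm res <= gapL.
Proof.
move=> C gapL eps0 saddle.
have r0 := l2norm_ge0 res.
have dres : dot ((2 * C / l2norm res) *: res) res = 2 * C * l2norm res.
  (* For a zero residual the quotient is 0 by convention, and both sides vanish. *)
  rewrite dotZl -sqr_l2norm; have [->|n0] := eqVneq (l2norm res) 0.
    by rewrite expr0n !mulr0.
  by field.
(* By the saddle inequality and Cauchy-Schwarz, [gapf] falls below 0 by at most [C * l2norm res];
   the factor 2 in the multiplier pays for this and leaves as much again. *)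
have ub : - (C * l2norm res) <= gapf.
  have := dot_le_l2norm lams res; have : 0 <= eps * l2norm res by rewrite mulr_ge0 // ltW.
  by rewrite /C mulrDl; lra.
have Cr : 0 <= C * l2norm res.
  by rewrite mulr_ge0 // addr_ge0 ?l2norm_ge0 // ltW.
rewrite /gapL dres; split; last by lra.
by rewrite ler_norml; apply/andP; split; lra.
Qed.

(** * Expectations of finite combinations of indicators *)

Section SimpleIntegral.
Local Open Scope classical_set_scope.
Variables (R : realType) (d : measure_display) (Omega : measurableType d).
Variables (P : probability Omega R) (I : finType) (c : I -> R) (E : I -> set Omega).
Hypothesis mE : forall i, measurable (E i).

Let int_term i : P.-integrable setT (fun om => (c i)%:E * (\1_(E i) om)%:E)%E.
Proof. by apply: integrableZl => //; exact: integrable_indic. Qed.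

Lemma integrable_simple :
  P.-integrable setT (EFin \o (fun om => \sum_i c i * \1_(E i) om)).
Proof.
rewrite (_ : _ \o _ = (fun om => \sum_i (c i)%:E * (\1_(E i) om)%:E)%E).
  by apply: integrable_sum.
by apply/funext => om /=; rewrite sumEFin.
Qed.

Lemma expectation_simple :
  ('E_P[fun om => (\sum_i c i * \1_(E i) om)%R] = \sum_i (c i)%:E * P (E i))%E.
Proof.
rewrite unlock; under eq_integral => om _ do rewrite -sumEFin.
under eq_integral => om _ do under eq_bigr => i _ do rewrite EFinM.
rewrite integral_sum //; apply: eq_bigr => i _.
by rewrite integralZl ?integral_indic ?setIT //; exact: integrable_indic.
Qed.

End SimpleIntegral.

(** * Adapted variables and the zero mean of the selection noise *)

Section RandomSelection.
Local Open Scope classical_set_scope.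
Variables (R : realType) (K : nat) (alpha : R) (T : nat).
Variables (d : measure_display) (Omega : measurableType d).
Variables (P : probability Omega R) (Lam : nat -> Omega -> {set 'I_K}).
Hypothesis sel : random_selection alpha T P Lam.

(** Only finitely many histories exist, so functional dependence on them makes [X] a simple function
    when [n <= T]. *)
Definition adapted n (X : Omega -> R) := forall om om',
  (forall s, (1 <= s <= n)%N -> Lam s om = Lam s om') -> X om = X om'.

Let past n := {ffun 'I_n -> {set 'I_K}}.

Let path n (F : past n) s : {set 'I_K} :=
  if insub s.-1 is Some i then F i else finset.set0.

(** The bound [s < n.+1] gives this event the form of [history] in [random_selection] at iteration
    [n.+1]. Iteration [s] is stored at ordinal [s.-1]. *)
Let cell n (F : past n) : set Omega :=
  [set om | forall s, (1 <= s < n.+1)%N -> Lam s om = path F s].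

Let cellE n (F : past n) om : cell F om <-> [ffun s : 'I_n => Lam s.+1 om] = F.
Proof.
split=> [Fom|<- s /andP[s1 sn]].
  apply/ffunP => s; rewrite ffunE Fom ?ltnS //= /path /=.
  by rewrite insubT //= => sn; congr (F _); exact: val_inj.
rewrite /path insubT => [|sn']; first by rewrite -ltnS prednK.
by rewrite ffunE /= prednK.
Qed.

Let measurable_cell n (F : past n) : (n <= T)%N -> measurable (cell F).
Proof.
move=> nT.
have -> : cell F = \bigcap_(s in [set: 'I_n]) \bigcap_(i in [set: 'I_K])
    (if i \in F s then [set om | i \in Lam s.+1 om]
     else ~` [set om | i \in Lam s.+1 om]).
  rewrite predeqE => om; rewrite cellE; split=> [<- s _ i _|H].
    by rewrite ffunE; case: ifPn => // /negP.
  apply/ffunP => s; apply/setP => i; rewrite ffunE.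
  by have := H s Logic.I i Logic.I; case: ifPn => // _ /negP/negbTE.
apply: fin_bigcap_measurable => // s _; apply: fin_bigcap_measurable => // i _.
have ms : measurable [set om | i \in Lam s.+1 om].
  by apply: (proj1 sel); rewrite /= (leq_trans (ltn_ord s)).
by case: ifP => // _; exact: measurableC.
Qed.

Let adaptedE n X : adapted n X ->
  exists c : past n -> R, forall om, X om = \sum_F c F * \1_(cell F) om.
Proof.
move=> aX.
(* The coefficient is the common value of [X] on the cell, or 0 if the cell is empty. *)
exists (fun F => xget 0 [set x | exists2 om, cell F om & X om = x]) => om.
pose F0 : past n := [ffun s : 'I_n => Lam s.+1 om].
have F0om : cell F0 om by exact/cellE.
rewrite (bigD1 F0) //= big1 => [|F FF0].
  rewrite indicE mem_set // mulr1 addr0.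
  have [om' F0om' <-] : [set x | exists2 om, cell F0 om & X om = x]
      (xget 0 [set x | exists2 om, cell F0 om & X om = x]).
    by apply: xgetPex; exists (X om), om.
  by apply: aX => s sn; rewrite (F0om s) ?(F0om' s) // ltnS.
rewrite indicE memNset ?mulr0 // => /cellE FE.
by rewrite -FE eqxx in FF0.
Qed.

Lemma adapted_integrable n X : (n <= T)%N -> adapted n X ->
  P.-integrable setT (EFin \o X).
Proof.
move=> nT /adaptedE[c XE]; rewrite (funext XE : X = _).
by apply: integrable_simple => F; exact: measurable_cell.
Qed.

Lemma adapted_noise n X i : (n < T)%N -> adapted n X ->
  adapted n.+1 (fun om => ((i \in Lam n.+1 om)%:R - alpha) * X om).
Proof.
move=> nT aX om om' H; rewrite (H n.+1) ?leqnn //; congr (_ * _).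
by apply: aX => s /andP[s1 sn]; rewrite H // s1 ltnW.
Qed.

(** [X] is constant on each history cell, and selecting [i] multiplies the probability of each cell
    by [alpha]. *)
Lemma expectation_noise n X i : (n < T)%N -> adapted n X ->
  ('E_P[fun om => (((i \in Lam n.+1 om)%:R - alpha) * X om)%R] = 0)%E.
Proof.
move=> nT /adaptedE[c XE]; pose A := [set om | i \in Lam n.+1 om].
have mC (F : past n) : measurable (cell F) by exact: measurable_cell (ltnW nT).
have mA : measurable A by exact: (proj1 sel n.+1 i nT).
have mAC (F : past n) : measurable (A `&` cell F) by exact: measurableI mA (mC F).
have -> : (fun om => ((i \in Lam n.+1 om)%:R - alpha) * X om) =
    (fun om => \sum_F c F * \1_(A `&` cell F) om) \-
    (fun om => \sum_F (c F * alpha) * \1_(cell F) om).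
  apply/funext => om /=; rewrite XE mulr_sumr -sumrB; apply: eq_bigr => F _.
  rewrite !indicE in_setI; have -> : (om \in A) = (i \in Lam n.+1 om).
    by apply/idP/idP => [/set_mem|H]; [|exact: (@mem_set _ A)].
  by rewrite -mulnb natrM; ring.
have PAC (F : past n) : P (A `&` cell F) = (alpha%:E * P (cell F))%E.
  exact: (proj2 sel n.+1 i (path F) nT).
rewrite expectationB ?expectation_simple //; last 2 first.
- by apply/Lfun1_integrable; exact: integrable_simple.
- by apply/Lfun1_integrable; exact: integrable_simple.
under eq_bigr do rewrite PAC muleA -EFinM.
rewrite subee // -expectation_simple // expectation_fin_num //.
by apply/Lfun1_integrable; exact: integrable_simple.
Qed.

Lemma expectation_sum_noise (X : nat -> 'I_K -> Omega -> R) :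
  (forall t i, (t < T)%N -> adapted t (X t i)) ->
  let N om := \sum_(0 <= t < T) \sum_i ((i \in Lam t.+1 om)%:R - alpha) * X t i om in
  P.-integrable setT (EFin \o N) /\ ('E_P[N] = 0)%E.
Proof.
move=> aX N.
pose h (t : 'I_T) (i : 'I_K) om := ((i \in Lam t.+1 om)%:R - alpha) * X t i om.
have int_h t i : P.-integrable setT (EFin \o h t i).
  apply: (adapted_integrable (ltn_ord t)).
  by apply: adapted_noise => //; exact: aX.
have NE : EFin \o N = (fun om => \sum_(t < T) \sum_i (EFin \o h t i) om)%E.
  apply/funext => om /=; rewrite /N big_mkord -sumEFin.
  by apply: eq_bigr => t _; rewrite -sumEFin.
have int_sum t : P.-integrable setT (fun om => \sum_i (EFin \o h t i) om)%E.
  by apply: integrable_sum.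
split; first by rewrite NE; apply: integrable_sum.
rewrite unlock -[X in integral _ _ X]/(EFin \o N) NE integral_sum // big1 // => t _.
rewrite integral_sum // big1 // => i _.
by have := expectation_noise i (ltn_ord t) (aX _ i (ltn_ord t)); rewrite unlock.
Qed.

Lemma expectation_le_noise (X Y N : Omega -> R) c :
  adapted T X -> adapted T Y ->
  P.-integrable setT (EFin \o N) -> ('E_P[N] = 0)%E ->
  (forall om, X om <= Y om - c * N om) -> ('E_P[X] <= 'E_P[Y])%E.
Proof.
move=> /(adapted_integrable (leqnn T)) iX /(adapted_integrable (leqnn T)) iY iN N0.
move=> XY; rewrite -[leRHS]adde0 -(mule0 (- c)%:E) -N0 unlock.
rewrite -integralZl // -integralD //; last exact: integrableZl.
apply: le_integral => //.
  by apply: integrableD => //; exact: integrableZl.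
by move=> om _ /=; rewrite -EFinM -EFinD lee_fin mulNr.
Qed.

End RandomSelection.

(** * Congruence and linearity of ergodic averages *)

Section ErgodicExtensionality.
Variables (R : realType) (alpha : R) (T n : nat).

Lemma eq_ergodic (x x' : nat -> 'cV[R]_n) :
  (forall t, (t <= T)%N -> x t = x' t) -> ergodic alpha T x = ergodic alpha T x'.
Proof.
move=> xx'; rewrite /ergodic xx' //; congr (_ *: (_ + _ *: _)).
by apply: eq_big_nat => t /andP[_ tT]; rewrite xx' // ltnW.
Qed.

Lemma mulmx_ergodic m (B : 'M[R]_(m, n)) (x : nat -> 'cV[R]_n) :
  B *m ergodic alpha T x = ergodic alpha T (fun t => B *m x t).
Proof. by rewrite /ergodic -scalemxAr mulmxDr -scalemxAr mulmx_sumr. Qed.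

End ErgodicExtensionality.

(** * The expected convergence rate *)

Section Rate.
Variables (R : realType) (L K d : nat).
Variables (f : 'cV[R]_L -> R) (g : 'cV[R]_L -> 'cV[R]_L).
Variables (A : 'M[R]_(L, \sum_(k < K) d)) (b : 'cV[R]_L).
Variables (alpha beta abar : R).
Hypothesis fg : smooth_convex f g.
Hypothesis A_orth : forall (i j : 'I_K) u v, i != j ->
  dot (Ablk A i *m u) (Ablk A j *m v) = 0.
Hypothesis alpha01 : 0 < alpha <= 1.
Hypothesis beta_gt0 : 0 < beta.
Hypothesis abar_ge : alpha ^- 2 - 1 <= alpha * abar.
Variables (v0 vs : 'cV[R]_(\sum_(k < K) d)) (w0 lam0 ws lams : 'cV[R]_L).
Hypothesis feasible : A *m vs + b = ws.
Hypothesis saddle : forall v w, f ws <= lagrangian f A b v w lams.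

(** Taking [mu = lam0] cancels the multiplier term, so this constant involves neither [eps], nor
    [T], nor the random run. *)
Definition rate_const : R :=
  potential alpha beta abar lam0 (A *m (v0 - vs)) (w0 - ws) lam0.

Lemma potential_const mu :
  potential alpha beta abar mu (A *m (v0 - vs)) (w0 - ws) lam0 =
  rate_const + (2 * beta)^-1 * l2norm (lam0 - mu) ^+ 2.
Proof.
by rewrite /rate_const /potential subrr dot0l mulr0 add0r sqr_l2norm; ring.
Qed.

Variables (eps : R) (T : nat) (disp : measure_display).
Variables (Omega : measurableType disp) (P : probability Omega R).
Variables (Lam : nat -> Omega -> {set 'I_K}).
Variables (v : nat -> Omega -> 'cV[R]_(\sum_(k < K) d)).
Variables (w lam : nat -> Omega -> 'cV[R]_L).
Hypothesis eps_gt0 : 0 < eps.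
Hypothesis T_gt0 : (0 < T)%N.
Hypothesis sel : random_selection alpha T P Lam.
Hypothesis runs : forall om, radmm_run f A b alpha beta abar T v0 w0 lam0
  (fun t => Lam t om) (fun t => v t om) (fun t => w t om) (fun t => lam t om).

Let vavg om := ergodic alpha T (fun t => v t om).
Let wavg om := ergodic alpha T (fun t => w t om).
Let res om := A *m vavg om + b - wavg om.
Let C := l2norm lams + eps.
Let mu om := (2 * C / l2norm (res om)) *: res om.
Let bound om := rate_const + (2 * beta)^-1 * l2norm (lam0 - mu om) ^+ 2.

Let noise om := \sum_(0 <= t < T)
  selection_noise A alpha beta vs ws (fun t => Lam t om) (fun t => v t om)
    (fun t => w t om) (fun t => lam t om) t.

Let agree n om om' := forall s, (1 <= s <= n)%N -> Lam s om = Lam s om'.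

Let determined n t om om' : agree n om om' -> (t <= n)%N -> (n <= T)%N ->
  [/\ forall i, Ablk A i *m submxcol (v t om) i = Ablk A i *m submxcol (v t om') i,
      w t om = w t om' & lam t om = lam t om'].
Proof.
move=> H tn nT.
apply: (run_determined fg alpha01 beta_gt0 abar_ge (runs om) (runs om')).
  exact: leq_trans nT.
by move=> s /andP[s1 st]; apply: H; rewrite s1 (leq_trans st).
Qed.

Let wavg_eq om om' : agree T om om' -> wavg om = wavg om'.
Proof.
by move=> H; apply: eq_ergodic => t tT; have [] := determined H tT (leqnn T).
Qed.

Let res_eq om om' : agree T om om' -> res om = res om'.
Proof.
move=> H; rewrite /res (wavg_eq H) !mulmx_ergodic; congr (_ + _ - _).
apply: eq_ergodic => t tT; have [Bv _ _] := determined H tT (leqnn T).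
by rewrite !mulmx_blocks; apply: eq_bigr => i _.
Qed.

(** The defects at time [t] involve [v] only through block images, hence depend only on the first
    [t] selections. *)
Let noise_mean0 : P.-integrable [set: Omega] (EFin \o noise) /\ ('E_P[noise] = 0)%E.
Proof.
apply: (expectation_sum_noise sel (X := fun t i om => block_defect A beta vs ws
  (fun t => v t om) (fun t => w t om) (fun t => lam t om) i t)) => t i tT om om' H.
have [Bv wE lamE] := determined H (leqnn t) (ltnW tT).
by rewrite /block_defect !mulmxBr Bv wE lamE.
Qed.

Let pathwise om :
  `|f (wavg om) - f ws| <= (bound om - noise om) / total_weight alpha T /\
  C * l2norm (res om) <= (bound om - noise om) / total_weight alpha T.
Proof.
have saddle_om : 0 <= f (wavg om) - f ws + dot lams (res om).
  have := saddle (vavg om) (wavg om); rewrite /lagrangian -/(res om); lra.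
have /= := aligned_gap eps_gt0 saddle_om; rewrite -/C -/(mu om) => -[gap1 gap2].
have := ergodic_run_bound fg A_orth alpha01 beta_gt0 abar_ge feasible (runs om)
  (mu om) T_gt0.
rewrite potential_const -/(bound om) -/(noise om) -/(wavg om) -/(vavg om) -/(res om).
rewrite mulrC -ler_pdivlMr ?total_weight_gt0 // => gapB.
by split; [exact: le_trans gap1 gapB|exact: le_trans gap2 gapB].
Qed.

Lemma radmm_ergodic_rate :
  ('E_P[fun om => `|f (wavg om) - f ws|%R] <=
   'E_P[fun om => (bound om / total_weight alpha T)%R])%E /\
  ('E_P[fun om => l2norm (res om)] <=
   'E_P[fun om => (bound om / (C * total_weight alpha T))%R])%E.
Proof.
have [iN N0] := noise_mean0.
have C_gt0 : 0 < C by rewrite ltr_wpDl ?l2norm_ge0.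
split.
  apply: (expectation_le_noise sel _ _ iN N0
    (c := (total_weight alpha T)^-1)) => [om om' H|om om' H|om].
  - by rewrite (wavg_eq H).
  - by rewrite /bound /mu (res_eq H).
  - by have [+ _] := pathwise om; rewrite mulrBl (mulrC _ (noise om)).
apply: (expectation_le_noise sel _ _ iN N0
  (c := (C * total_weight alpha T)^-1)) => [om om' H|om om' H|om].
- by rewrite (res_eq H).
- by rewrite /bound /mu (res_eq H).
- have [_] := pathwise om; rewrite mulrC -ler_pdivlMr // => /le_trans; apply.
  rewrite (_ : bound om / _ - _ = (bound om - noise om) / total_weight alpha T / C) //.
  by rewrite invfM; ring.
Qed.

End Rate.

Theorem theorem1 (R : realType) (M N K : nat)
  (hM : (1 <= M)%N) (hN : (1 <= N)%N) (hK : (1 <= K)%N)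
  (h : 'I_K -> 'cV[R[i]]_(dimMN M N)) (sigma : 'I_K -> R)
  (p : 'I_M -> R) (hp : forall m, 0 <= p m) (sc : R) (hsc : 0 < sc)
  (alpha beta abar : R)
  (halpha : 0 < alpha <= 1) (hbeta : 0 < beta)
  (habar : alpha ^- 2 - 1 <= alpha * abar)
  (v0 : 'cV[R]_(dimV M N K)) (w0 lam0 : 'cV[R]_(dimL M N K))
  (vs : 'cV[R]_(dimV M N K)) (ws lams : 'cV[R]_(dimL M N K)) :
  let A := Amat h sc in
  let b := bvec M N sigma in
  let f := half_sqdist (@Dset R M N K p sc) in
  primal_optimal f A b vs ws ->
  dual_optimal f A b lams ->
  exists Const : R,
  forall (eps : R) (T : nat)
    (d : measure_display) (Omega : measurableType d) (P : probability Omega R)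
    (Lam : nat -> Omega -> {set 'I_K})
    (v : nat -> Omega -> 'cV[R]_(dimV M N K))
    (w lam : nat -> Omega -> 'cV[R]_(dimL M N K)),
  0 < eps -> (1 <= T)%N ->
  random_selection alpha T P Lam ->
  (forall om, radmm_run f A b alpha beta abar T v0 w0 lam0
     (fun t => Lam t om) (fun t => v t om) (fun t => w t om)
     (fun t => lam t om)) ->
  let vavg om : 'cV[R]_(dimV M N K) := ergodic alpha T (fun t => v t om) in
  let wavg om : 'cV[R]_(dimL M N K) := ergodic alpha T (fun t => w t om) in
  let res om : 'cV[R]_(dimL M N K) := A *m vavg om + b - wavg om in
  let C : R := l2norm lams + eps in
  let lamavg om : 'cV[R]_(dimL M N K) :=
    (2 * C / l2norm (res om)) *: res om in
  ('E_P[fun om => (`|f (wavg om) - f ws|)%R] <=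
   'E_P[fun om => ((Const + (2 * beta)^-1 * l2norm (lam0 - lamavg om) ^+ 2)
                   / (1 + alpha * (T%:R - 1)))%R])%E /\
  ('E_P[fun om => l2norm (res om)] <=
   'E_P[fun om => ((Const + (2 * beta)^-1 * l2norm (lam0 - lamavg om) ^+ 2)
                   / (C * (1 + alpha * (T%:R - 1))))%R])%E.
Proof.
move=> A b f primal dual.
have fg : smooth_convex f _ := smooth_convex_Dset sc hp.
exists (rate_const A alpha beta abar v0 vs w0 lam0 ws).
move=> eps T d Omega P Lam v w lam eps0 T0 sel runs.
exact: (radmm_ergodic_rate fg (dot_Ablk_Amat h sc) halpha hbeta habar
  primal.1 (dual_optimal_saddle fg primal dual) eps0 T0 sel runs).
Qed.
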